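(* Let $\mathbf{S}=\{A_1,\dots,A_m\}\subset\mathbb{S}^n$ and $b\in\mathbb{R}^m$. If $b\in SH(\mathbf{S})$, then there exists $X\in\mathbf{\Delta}_n$ with $p(X)=(A_1\bullet X,\dots,A_m\bullet X)^T=b$ such that $X$ can be written as a convex combination of at most $m+1$ extreme points of $\mathbf{\Delta}_n$. More precisely, there exist extreme points $X_1,\dots,X_t$ of $\mathbf{\Delta}_n$, with $t\le m+1$, such that $$X=\sum_{i=1}^t\alpha_iX_i,\qquad \sum_{i=1}^t\alpha_i=1,\qquad \alpha_i\ge 0.$$
   Context: $\mathbb{S}^n$ is the space of real symmetric $n\times n$ matrices with inner product $X\bullet Y=\mathrm{Tr}(XY)$. The spectraplex is $\mathbf{\Delta}_n=\{X\in\mathbb{S}^n: \mathrm{Tr}(X)=1,\ X\succeq 0\}$ (with $X\succeq0$ meaning positive semidefinite). For $\mathbf{S}=\{A_1,\dots,A_m\}\subset\mathbb{S}^n$ and $X\in\mathbf{\Delta}_n$, $p(X)=(A_1\bullet X,\dots,A_m\bullet X)^T\in\mathbb{R}^m$; the spectrahull is $SH(\mathbf{S})=\{p(X): X\in\mathbf{\Delta}_n\}\subset\mathbb{R}^m$. *)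

(* Defs.v *)
From mathcomp Require Import all_boot all_order all_algebra.
From mathcomp Require Import boolp classical_sets reals.

Set Implicit Arguments.
Unset Strict Implicit.
Unset Printing Implicit Defensive.

Import Order.TTheory GRing.Theory Num.Theory.

Local Open Scope ring_scope.
Local Open Scope classical_set_scope.

Definition sym_inner (R : realType) (n : nat) (X Y : 'M[R]_n) : R :=
  \tr (X *m Y).

(* Symmetry is required explicitly: over the reals it does not follow from
   nonnegativity of the quadratic form. *)
Definition psd (R : realType) (n : nat) (X : 'M[R]_n) : Prop :=
  X \is symmetricmx /\
  (forall v : 'cV[R]_n, 0 <= (v^T *m X *m v) ord0 ord0).

(* Empty for [n = 0], where every trace is [0]. *)
Definition spectraplex (R : realType) (n : nat) : set 'M[R]_n :=
  [set X | \tr X = 1 /\ psd X].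

(* [S = {A_1, ..., A_m}] is an [m]-indexed family, so that [p X] has [m]
   coordinates; repetitions are allowed. *)
Definition trace_map (R : realType) (n m : nat) (A : 'I_m -> 'M[R]_n)
  (X : 'M[R]_n) : 'cV[R]_m := \col_(i < m) sym_inner (A i) X.

Definition spectrahull (R : realType) (n m : nat) (A : 'I_m -> 'M[R]_n) :
  set 'cV[R]_m := trace_map A @` @spectraplex R n.

Definition extreme_point (R : realType) (V : lmodType R) (C : set V) (x : V) :
  Prop :=
  C x /\
  (forall (y z : V) (t : R), C y -> C z -> 0 < t < 1 ->
     x = t *: y + (1 - t) *: z -> y = x /\ z = x).

(* Main.v *)
(* A positive semidefinite matrix is a nonnegative combination of the extreme
   points [u u^T / |u|^2] of the spectraplex.  Applying the conic Caratheodory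
   theorem in dimension [m + 1] to the images of these points under
   [X |-> (tr X, p X)] keeps at most [m + 1] of them; the trace coordinate
   guarantees that the new weights still sum to [1]. *)
Require Import Defs.
From mathcomp Require Import all_boot all_order all_algebra ring lra.
From mathcomp Require Import boolp classical_sets reals.

Set Implicit Arguments.
Unset Strict Implicit.
Unset Printing Implicit Defensive.

Import Order.TTheory GRing.Theory Num.Theory.

Local Open Scope ring_scope.
Local Open Scope classical_set_scope.

(** More than [k] vectors are linearly dependent; shifting the weights along a dependency until one
    of them vanishes discards a vector, and induction on [N] does the rest. *)
Lemma conic_caratheodory (F : realFieldType) (k N : nat) (f : 'I_N -> 'cV[F]_k)
    (a : 'I_N -> F) : (forall i, 0 <= a i) ->
  exists (t : nat) (g : 'I_t -> 'I_N) (b : 'I_t -> F),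
    [/\ (t <= k)%N, forall i, 0 <= b i
      & \sum_i b i *: f (g i) = \sum_i a i *: f i].
Proof.
elim: N f a => [|N IHN] f a a_ge0; first by exists 0%N, id, a.
have [leNk|ltkN] := leqP N.+1 k; first by exists N.+1, id, a.
have [c [i0 ci0_gt0] cf0] :
    exists2 c : 'I_N.+1 -> F, exists i, 0 < c i & \sum_i c i *: f i = 0.
  (* The rows of [M] are the vectors; having more rows than columns, [M] has a nonzero left kernel
     vector. *)
  pose M : 'M[F]_(N.+1, k) := \matrix_(i, j) f i j ord0.
  pose c := nz_row (kermx M).
  have c_neq0 : c != 0.
    rewrite nz_row_eq0 kermx_eq0 /row_free neq_ltn.
    by rewrite (leq_ltn_trans (rank_leq_col M)).
  have cM0 : c *m M = 0 by apply/sub_kermxP/nz_row_sub.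
  have cf0 : \sum_i c ord0 i *: f i = 0.
    apply/matrixP => j l; rewrite summxE (ord1 l) [RHS]mxE.
    have := congr1 (fun A : 'rV[F]_k => A ord0 j) cM0; rewrite !mxE => cMj.
    rewrite -[RHS]cMj.
    by apply: eq_bigr => i _; rewrite !mxE.
  have [i ci_neq0] : exists i, c ord0 i != 0.
    by have /rV0Pn[i] := c_neq0; exists i.
  (* A sign change makes some coefficient positive, so that the ratio test below has a candidate. *)
  have [ci_lt0|ci_gt0|ci0] := ltgtP (c ord0 i) 0.
  - exists (fun i => - c ord0 i); first by exists i; rewrite oppr_gt0.
    by under eq_bigr do rewrite scaleNr; rewrite sumrN cf0 oppr0.
  - by exists (c ord0); first by exists i.
  - by rewrite ci0 eqxx in ci_neq0.
(* Ratio test: [a j / c j] is the largest multiple of [c] that can be subtracted from [a] with all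
   weights staying nonnegative, and it makes the weight at [j] zero. *)
case: (@arg_minP _ _ _ i0 (fun i => 0 < c i) (fun i => a i / c i) ci0_gt0) =>
  j cj_gt0 j_min.
pose a' i := a i - a j / c j * c i.
have a'_ge0 i : 0 <= a' i.
  rewrite subr_ge0; have [ci_gt0|ci_le0] := ltP 0 (c i).
    by rewrite -ler_pdivlMr// j_min.
  by rewrite (le_trans _ (a_ge0 i))// mulr_ge0_le0// divr_ge0// ltW.
have a'j0 : a' j = 0 by rewrite /a' divfK ?subrr// gt_eqF.
have [t [g [b [le_tk b_ge0 bE]]]] :=
  IHN (f \o lift j) (a' \o lift j) (fun i => a'_ge0 _).
exists t, (lift j \o g), b; split=> //.
transitivity (\sum_i a' i *: f i).
  by rewrite (bigD1_ord j)//= a'j0 scale0r add0r.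
under eq_bigr do rewrite scalerBl -scalerA.
by rewrite sumrB -scaler_sumr cf0 scaler0 subr0.
Qed.

(** * Positive semidefinite matrices and the extreme points of the spectraplex *)

Section PositiveSemidefinite.
Variables (R : realType) (n : nat).
Implicit Types (X Y Z P : 'M[R]_n) (u v w : 'cV[R]_n) (c t : R).

(** For [X = 1%:M] this is the Euclidean inner product. *)
Definition bform X u w : R := (u^T *m X *m w) ord0 ord0.

Lemma bformDl X u v w : bform X (u + v) w = bform X u w + bform X v w.
Proof. by rewrite /bform linearD !mulmxDl mxE. Qed.

Lemma bformDr X u v w : bform X w (u + v) = bform X w u + bform X w v.
Proof. by rewrite /bform mulmxDr mxE. Qed.

Lemma bformZl X c u w : bform X (c *: u) w = c * bform X u w.
Proof. by rewrite /bform linearZ -!scalemxAl mxE. Qed.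

Lemma bformZr X c u w : bform X u (c *: w) = c * bform X u w.
Proof. by rewrite /bform -scalemxAr mxE. Qed.

Lemma bformD X Y u w : bform (X + Y) u w = bform X u w + bform Y u w.
Proof. by rewrite /bform mulmxDr mulmxDl mxE. Qed.

Lemma bformZ c X u w : bform (c *: X) u w = c * bform X u w.
Proof. by rewrite /bform -scalemxAr -scalemxAl mxE. Qed.

Lemma bform_delta_l X i w : bform X (delta_mx i ord0) w = (X *m w) i ord0.
Proof. by rewrite /bform trmx_delta -mulmxA -rowE mxE. Qed.

Lemma bform_delta X i j : bform X (delta_mx i ord0) (delta_mx j ord0) = X i j.
Proof. by rewrite bform_delta_l -colE mxE. Qed.

Lemma bform_sym X u w : X^T = X -> bform X u w = bform X w u.
Proof.
move=> XT.
by rewrite /bform -[u^T *m X *m w]trmxK mxE !trmx_mul trmxK XT mulmxA.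
Qed.

Lemma bform_outer u v w :
  bform (u *m u^T) v w = bform 1%:M v u * bform 1%:M w u.
Proof.
rewrite (@bform_sym 1%:M w) ?trmx1// /bform !mulmx1 mulmxA -mulmxA.
by rewrite mxE big_ord1.
Qed.

Lemma psdP X : psd X <-> X^T = X /\ forall v, 0 <= bform X v v.
Proof.
have symE : X \is symmetricmx <-> X^T = X.
  rewrite is_hermitianmxE expr0 scale1r map_mx_id; first by split=> [/eqP|->].
  by [].
by rewrite /psd symE.
Qed.

Lemma psdD X Y : psd X -> psd Y -> psd (X + Y).
Proof.
move=> /psdP[XT X_ge0] /psdP[YT Y_ge0]; apply/psdP; split=> [|v].
  by rewrite linearD/= XT YT.
by rewrite bformD addr_ge0.
Qed.

Lemma psdZ c X : 0 <= c -> psd X -> psd (c *: X).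
Proof.
move=> c_ge0 /psdP[XT X_ge0]; apply/psdP; split=> [|v].
  by rewrite linearZ/= XT.
by rewrite bformZ mulr_ge0.
Qed.

Lemma psd0 : psd (0 : 'M[R]_n).
Proof.
by apply/psdP; split=> [|v]; rewrite ?trmx0// /bform mulmx0 mul0mx mxE.
Qed.

Lemma psd_outer u : psd (u *m u^T).
Proof.
apply/psdP; split=> [|v]; first by rewrite trmx_mul trmxK.
by rewrite bform_outer -expr2 sqr_ge0.
Qed.

(** The form at [u + s *: w] is a polynomial in [s] that is never negative; it is affine when
    [bform X w w] vanishes, hence the two cases. *)
Lemma psd_Cauchy_Schwarz X u w : psd X ->
  bform X u w ^+ 2 <= bform X u u * bform X w w.
Proof.
move=> /psdP[XT X_ge0].
have X_quad s : 0 <= bform X u u + 2 * s * bform X u w + s ^+ 2 * bform X w w.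
  have := X_ge0 (u + s *: w); rewrite !(bformDl, bformDr, bformZl, bformZr).
  by rewrite (bform_sym w u XT); lra.
have := X_ge0 w; rewrite le_eqVlt => /predU1P[w0|w_gt0].
  rewrite -w0 mulr0; have [->|uw_neq0] := eqVneq (bform X u w) 0.
    by rewrite expr0n.
  (* This [s] gives the affine polynomial the value -1, a contradiction. *)
  have := X_quad (- (bform X u u + 1) / (2 * bform X u w)).
  rewrite -w0; set a := bform X u u; set b := bform X u w in uw_neq0 *.
  have -> : a + 2 * (- (a + 1) / (2 * b)) * b +
      (- (a + 1) / (2 * b)) ^+ 2 * 0 = -1 by field.
  lra.
(* Here [s] is the minimiser of the quadratic polynomial. *)
have := X_quad (- bform X u w / bform X w w).
have w_neq0 : bform X w w != 0 by rewrite gt_eqF.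
have -> : bform X u u + 2 * (- bform X u w / bform X w w) * bform X u w +
    (- bform X u w / bform X w w) ^+ 2 * bform X w w =
    (bform X u u * bform X w w - bform X u w ^+ 2) / bform X w w by field.
by rewrite pmulr_lge0 ?invr_gt0// subr_ge0.
Qed.

(** Cauchy-Schwarz against each basis vector bounds the square of every coordinate of [X *m w] by
    0. *)
Lemma psd_isotropic_ker X w : psd X -> bform X w w = 0 -> X *m w = 0.
Proof.
move=> X_psd w0; apply/matrixP => i j; rewrite ord1 -bform_delta_l [RHS]mxE.
have := psd_Cauchy_Schwarz (delta_mx i ord0) w X_psd; rewrite w0 mulr0 => le0.
by apply/eqP; rewrite -sqrf_eq0 eq_le le0 sqr_ge0.
Qed.

(** At [v] the subtracted form is the square of [bform X v (delta_mx i ord0)] over [X i i], which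
    Cauchy-Schwarz bounds by [bform X v v]. *)
Lemma psd_Schur_complement X i : psd X ->
  psd (X - (X i i)^-1 *: (col i X *m (col i X)^T)).
Proof.
move=> X_psd; have /psdP[XT X_ge0] := X_psd.
apply/psdP; split=> [|v].
  by rewrite linearB linearZ/= trmx_mul trmxK XT.
rewrite -scaleNr bformD bformZ bform_outer.
have -> : bform 1%:M v (col i X) = bform X v (delta_mx i ord0).
  by rewrite /bform mulmx1 colE mulmxA.
have := psd_Cauchy_Schwarz v (delta_mx i ord0) X_psd.
have := X_ge0 (delta_mx i ord0); rewrite bform_delta.
(* If [X i i = 0], its inverse is 0 by convention and nothing is subtracted. *)
rewrite le_eqVlt => /predU1P[<- _|Xii_gt0].
  by rewrite invr0 oppr0 mul0r addr0.
by rewrite -ler_pdivrMr// mulNr subr_ge0 mulrC expr2.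
Qed.

(* With [P] the orthogonal projection on the line of [u], both [Y] and [Z] are
   nonnegative on the kernel of [P] while their combination vanishes there, so
   [Y] kills that kernel and hence is a multiple of [P]. *)
Lemma spectraplex_rank1_face Y Z P u t :
  bform 1%:M u u != 0 -> P = (bform 1%:M u u)^-1 *: (u *m u^T) ->
  0 < t < 1 -> spectraplex Y -> spectraplex Z ->
  P = t *: Y + (1 - t) *: Z -> Y = P.
Proof.
move=> c_neq0 PE /andP[t_gt0 t_lt1] [trY Y_psd] [_ Z_psd] PYZ.
have /psdP[YT Y_ge0] := Y_psd; have /psdP[_ Z_ge0] := Z_psd.
set c := bform 1%:M u u in c_neq0 PE.
have uTuE (M : 'M[R]_n) : u^T *m M *m u = (bform M u u)%:M
  by rewrite [LHS]mx11_scalar.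
have PT : P^T = P by rewrite PE linearZ/= trmx_mul trmxK.
have Pu : P *m u = u.
  rewrite PE -scalemxAl -mulmxA -[u^T]mulmx1 uTuE mul_mx_scalar scalerA.
  by rewrite mulVf// scale1r.
have PP : P *m P = P by rewrite {2}PE -scalemxAr mulmxA Pu -PE.
(* It suffices that [Y] kills each column of [1%:M - P], on which the form of [P] vanishes. *)
have YP : Y = Y *m P.
  apply/eqP; rewrite -subr_eq0 -{1}[Y]mulmx1 -mulmxBr; apply/eqP.
  apply/matrixP => i j; rewrite [RHS]mxE.
  set Q := 1%:M - P.
  have -> : (Y *m Q) i j = (Y *m col j Q) i ord0.
    by rewrite !mxE; apply: eq_bigr => k _; rewrite !mxE.
  rewrite psd_isotropic_ker ?mxE//.
  have : bform P (col j Q) (col j Q) = 0.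
    rewrite /bform -mulmxA colE (mulmxA P) /Q mulmxBr mulmx1 PP subrr.
    by rewrite mul0mx mulmx0 mxE.
  rewrite PYZ bformD !bformZ => sum0.
  have := Y_ge0 (col j Q); have := Z_ge0 (col j Q).
  set y := bform Y _ _ in sum0 *; set z := bform Z _ _ in sum0 * => z0 y0.
  by apply/eqP; rewrite eq_le y0 andbT; nra.
have YPYP : Y = P *m Y *m P by rewrite -mulmxA -YP -{1}YT {1}YP trmx_mul PT YT.
have [d YE] : exists d, Y = d *: P.
  exists (c^-1 * bform Y u u); rewrite [LHS]YPYP PE.
  rewrite -!scalemxAl -!scalemxAr !mulmxA -(mulmxA u u^T) -(mulmxA u) uTuE.
  by rewrite mul_mx_scalar -scalemxAl !scalerA mulrC.
(* Both [Y] and [P] have trace 1, which forces the factor [d] to be 1. *)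
have trP : \tr P = 1.
  rewrite PE mxtraceZ mxtrace_mulC -[u^T]mulmx1 uTuE mxtrace_scalar mulr1n.
  by rewrite mulVf.
by move: trY; rewrite YE mxtraceZ trP mulr1 => ->; rewrite scale1r.
Qed.

Lemma norm2_gt0 u : u != 0 -> 0 < bform 1%:M u u.
Proof.
move=> /cV0Pn[i ui_neq0]; rewrite /bform mulmx1 mxE (bigD1 i)//= mxE.
rewrite ltr_pwDl ?sumr_ge0// => [|j _]; rewrite ?mxE -expr2 ?sqr_ge0//.
by rewrite exprn_even_gt0.
Qed.

Lemma spectraplex_rank1_extreme u : u != 0 ->
  extreme_point (@spectraplex R n) ((bform 1%:M u u)^-1 *: (u *m u^T)).
Proof.
move=> /norm2_gt0 c_gt0; have c_neq0 := lt0r_neq0 c_gt0.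
split=> [|Y Z t Y_in Z_in t01 PE].
  split; last by apply: psdZ (psd_outer u); rewrite invr_ge0 ltW.
  rewrite mxtraceZ mxtrace_mulC [u^T *m u]mx11_scalar mxtrace_scalar mulr1n.
  by rewrite -[u^T]mulmx1 mulVf.
split; first exact: (spectraplex_rank1_face c_neq0 _ t01 Y_in Z_in PE).
apply: (@spectraplex_rank1_face Z Y _ u (1 - t)) => //; first lra.
by rewrite PE subKr addrC.
Qed.

(* Symmetric Gaussian elimination: splitting off the rank one matrix
   [(X i i)^-1 *: col i X *m (col i X)^T] clears the [i]-th diagonal entry,
   which avoids the spectral theorem. *)
Lemma psd_sum_extreme X : psd X ->
  exists s : seq (R * 'M[R]_n),
    {in s, forall p, 0 <= p.1 /\ extreme_point (@spectraplex R n) p.2} /\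
    X = \sum_(p <- s) p.1 *: p.2.
Proof.
(* Induction on the number of nonzero diagonal entries; once there are none, Cauchy-Schwarz forces
   [X = 0]. *)
have [k] := ubnP #|[pred i | X i i != 0]|.
elim: k X => // k IHk X; rewrite ltnS => le_k X_psd.
have /psdP[XT X_ge0] := X_psd.
have [i /= Xii_neq0|diag0] := pickP [pred i | X i i != 0]; last first.
  exists [::]; split=> //; rewrite big_nil; apply/matrixP => i j.
  rewrite -bform_delta [RHS]mxE; apply/eqP.
  rewrite -sqrf_eq0 eq_le sqr_ge0 andbT.
  rewrite (le_trans (psd_Cauchy_Schwarz _ _ X_psd))// bform_delta.
  by have /negPn/eqP-> := negbT (diag0 i); rewrite mul0r.
have Xd_ge0 j : 0 <= X j j by rewrite -bform_delta.
have Xii_gt0 : 0 < X i i by rewrite lt_neqAle eq_sym Xii_neq0 Xd_ge0.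
pose u := col i X; pose c := bform 1%:M u u.
have c_gt0 : 0 < c by apply/norm2_gt0/cV0Pn; exists i; rewrite mxE.
have Y_psd := psd_Schur_complement i X_psd.
set Y := X - _ in Y_psd; have /psdP[_ Y_ge0] := Y_psd.
have YE j : Y j j = X j j - (X i i)^-1 * X j i ^+ 2.
  by rewrite !mxE big_ord1 !mxE expr2.
have [||s [s_ext YsE]] := IHk Y.
(* A zero diagonal entry of [X] stays zero in [Y], being only decreased yet nonnegative, while entry
   [i] becomes zero: the count drops. *)
- apply: leq_trans le_k; apply/proper_card/properP; split.
    apply/fintype.subsetP => j; rewrite !inE; apply: contra_neq => Xjj0.
    apply/eqP; rewrite eq_le -{2}bform_delta Y_ge0 andbT YE Xjj0 sub0r oppr_le0.
    by rewrite mulr_ge0 ?sqr_ge0// invr_ge0 Xd_ge0.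
  by exists i; rewrite ?inE// YE expr2 mulKf// subrr eqxx.
- exact: Y_psd.
(* Dividing by [c] normalises the trace of [u *m u^T] to 1; the weight absorbs this factor. *)
exists (((X i i)^-1 * c, c^-1 *: (u *m u^T)) :: s); split=> [p|].
  rewrite inE => /predU1P[->/=|/s_ext//]; split.
    by rewrite mulr_ge0 ?invr_ge0 ?ltW.
  by apply: spectraplex_rank1_extreme; apply/cV0Pn; exists i; rewrite mxE.
rewrite big_cons/= scalerA mulfK ?gt_eqF// -YsE.
by rewrite addrC subrK.
Qed.
End PositiveSemidefinite.

Theorem theorem9 (R : realType) (n m : nat) (A : 'I_m -> 'M[R]_n)
  (hA : forall i : 'I_m, A i \is symmetricmx) (b : 'cV[R]_m)
  (hb : spectrahull A b) :
  exists X : 'M[R]_n,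
    [/\ spectraplex X,
        trace_map A X = b
      & exists (t : nat) (Xs : 'I_t -> 'M[R]_n) (alpha : 'I_t -> R),
          [/\ (t <= m.+1)%N,
              forall i : 'I_t, extreme_point (@spectraplex R n) (Xs i),
              X = \sum_(i < t) alpha i *: Xs i,
              \sum_(i < t) alpha i = 1
            & forall i : 'I_t, 0 <= alpha i]].
Proof.
have [X0 [trX0 X0_psd] X0b] := hb.
have [s [s_ext X0E]] := psd_sum_extreme X0_psd.
have {}s_ext i : 0 <= (tnth (in_tuple s) i).1 /\
    extreme_point (@spectraplex R n) (tnth (in_tuple s) i).2.
  by apply: s_ext; rewrite mem_tnth.
pose lift_map (X : 'M[R]_n) : 'cV[R]_(1 + m) :=
  col_mx (\tr X)%:M (trace_map A X).
have lift_map_sum N (a : 'I_N -> R) (Xs : 'I_N -> 'M[R]_n) :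
    lift_map (\sum_i a i *: Xs i) = \sum_i a i *: lift_map (Xs i).
  have lift_mapD : {morph lift_map : X Y / X + Y}.
    move=> X Y; rewrite /lift_map add_col_mx linearD/= raddfD/=; congr col_mx.
    by apply/colP => i; rewrite !mxE /sym_inner mulmxDr linearD.
  have lift_map0 : lift_map 0 = 0.
    by apply: (addrI (lift_map 0)); rewrite -lift_mapD !addr0.
  rewrite (big_morph lift_map lift_mapD lift_map0); apply: eq_bigr => i _.
  rewrite /lift_map scale_col_mx linearZ/= scale_scalar_mx; congr col_mx.
  by apply/colP => j; rewrite !mxE /sym_inner -scalemxAr linearZ.
have [t [g [b' [le_tm b'_ge0 b'E]]]] :=
  conic_caratheodory (fun i => lift_map (tnth (in_tuple s) i).2)
    (fun i => (s_ext i).1).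
pose Xs i := (tnth (in_tuple s) (g i)).2.
have Xs_ext i : extreme_point (@spectraplex R n) (Xs i) := (s_ext (g i)).2.
pose X := \sum_i b' i *: Xs i.
have : lift_map X = lift_map X0.
  by rewrite lift_map_sum b'E -lift_map_sum X0E [in RHS]big_tnth.
(* The two blocks of the lifted equality preserve the trace and the value of [trace_map A]. *)
move=> /eq_col_mx[trXE pXE].
have trX : \tr X = 1.
  have := congr1 (fun M : 'M[R]_1 => \tr M) trXE.
  by rewrite !mxtrace_scalar trX0.
exists X; split.
- split=> //; rewrite /X; elim/big_ind: _ => [|Y Z|i _];
    [exact: psd0|exact: psdD|].
  by apply: psdZ => //; have [[]] := Xs_ext i.
- by rewrite pXE.
exists t, Xs, b'; split=> //.
(* Each [Xs i] has trace 1, so the trace of [X] is the sum of the weights. *)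
rewrite -trX linear_sum; apply: eq_bigr => i _.
by have [[trXs _] _] := Xs_ext i; rewrite linearZ/= trXs mulr1.
Qed.
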